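(* Let $L>0$, let $f:\mathbb{R}^n\to\mathbb{R}$ be a convex $L$-smooth function, and let $\{x_k\}_{k=0}^{\infty}$ be the sequence of iterates produced by gradient descent, i.e. $x_k=x_{k-1}-\eta\nabla f(x_{k-1})$ for all $k\ge 1$, starting from some $x_0\in\mathbb{R}^n$, using a constant step size $\eta\in\left(0,\frac{2}{L}\right]$. Then the sequence $\{\|\nabla f(x_k)\|\}_{k=0}^{\infty}$ is non-increasing.
   Context: A function $f:\mathbb{R}^n\to\mathbb{R}$ is $L$-smooth if it is differentiable and its gradient is $L$-Lipschitz with respect to the Euclidean norm: $\|\nabla f(x)-\nabla f(y)\|\le L\|x-y\|$ for all $x,y\in\mathbb{R}^n$. Here $\|\cdot\|$ is the Euclidean norm. *)

(* Defs.v *)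
From mathcomp Require Import all_boot all_order all_algebra.
From mathcomp Require Import all_classical all_reals all_analysis.
Import Order.TTheory GRing.Theory Num.Theory.
Import numFieldNormedType.Exports.

Set Implicit Arguments.
Unset Strict Implicit.
Unset Printing Implicit Defensive.

Local Open Scope classical_set_scope.
Local Open Scope ring_scope.

(* The normed-module structure that the library puts on ['rV[R]_n] carries the
   max norm, so the Euclidean norm is defined here. The topology is the usual
   one for both, hence [differentiable] is the usual Frechet differentiability. *)
Definition enorm (R : realType) (n : nat) (v : 'rV[R]_n) : R :=
  Num.sqrt (\sum_(i < n) v ord0 i ^+ 2).

Definition grad (R : realType) (n : nat) (f : 'rV[R]_n -> R) (x : 'rV[R]_n) :
    'rV[R]_n :=
  \row_(i < n) 'D_(delta_mx ord0 i) f x.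

Definition smooth (R : realType) (n : nat) (L : R) (f : 'rV[R]_n -> R) : Prop :=
  (forall x, differentiable f x) /\
  (forall x y, enorm (grad f x - grad f y) <= L * enorm (x - y)).

(* Main.v *)
(* Convexity and L-smoothness make the gradient cocoercive (Baillon-Haddad):
   [|grad f x - grad f y|^2 <= L <grad f x - grad f y, x - y>]. For one step,
   with g = grad f x_k, g' = grad f x_(k+1) and w = g - g', we have
   x_k - x_(k+1) = eta g, so |w|^2 <= L eta <w, g> <= 2 <w, g>, and
   |g'|^2 = |g|^2 - 2 <w, g> + |w|^2 <= |g|^2. *)
Require Import Defs.
From mathcomp Require Import all_boot all_order all_algebra.
From mathcomp Require Import all_classical all_reals all_analysis.
From mathcomp Require Import ring lra.
Import Order.TTheory GRing.Theory Num.Theory.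
Import numFieldNormedType.Exports.

Local Open Scope classical_set_scope.
Local Open Scope ring_scope.

Definition dot {R : realType} {n : nat} (u v : 'rV[R]_n) : R :=
  \sum_(i < n) u ord0 i * v ord0 i.

Lemma dotC {R : realType} {n : nat} (u v : 'rV[R]_n) : dot u v = dot v u.
Proof. by apply: eq_bigr => i _; rewrite mulrC. Qed.

Lemma dotDl {R : realType} {n : nat} (u v w : 'rV[R]_n) :
  dot (u + v) w = dot u w + dot v w.
Proof. by rewrite -big_split; apply: eq_bigr => i _; rewrite mxE mulrDl. Qed.

Lemma dotZl {R : realType} {n : nat} (a : R) (u v : 'rV[R]_n) :
  dot (a *: u) v = a * dot u v.
Proof. by rewrite mulr_sumr; apply: eq_bigr => i _; rewrite mxE mulrA. Qed.

Lemma dotNl {R : realType} {n : nat} (u v : 'rV[R]_n) : dot (- u) v = - dot u v.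
Proof. by rewrite -scaleN1r dotZl mulN1r. Qed.

Lemma dotDr {R : realType} {n : nat} (u v w : 'rV[R]_n) :
  dot u (v + w) = dot u v + dot u w.
Proof. by rewrite !(dotC u) dotDl. Qed.

Lemma dotZr {R : realType} {n : nat} (a : R) (u v : 'rV[R]_n) :
  dot u (a *: v) = a * dot u v.
Proof. by rewrite !(dotC u) dotZl. Qed.

Lemma dotNr {R : realType} {n : nat} (u v : 'rV[R]_n) : dot u (- v) = - dot u v.
Proof. by rewrite !(dotC u) dotNl. Qed.

Definition dotE := (@dotDl, @dotDr, @dotNl, @dotNr, @dotZl, @dotZr).

Lemma dot_ge0 {R : realType} {n : nat} (u : 'rV[R]_n) : 0 <= dot u u.
Proof. by apply: sumr_ge0 => i _; rewrite -expr2 sqr_ge0. Qed.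

Lemma enormE {R : realType} {n : nat} (u : 'rV[R]_n) :
  enorm u = Num.sqrt (dot u u).
Proof. by congr Num.sqrt; apply: eq_bigr => i _; rewrite expr2. Qed.

Lemma enorm_sqr {R : realType} {n : nat} (u : 'rV[R]_n) :
  enorm u ^+ 2 = dot u u.
Proof. by rewrite enormE sqr_sqrtr ?dot_ge0. Qed.

Lemma derive_grad {R : realType} {n : nat} (f : 'rV[R]_n -> R)
    (x v : 'rV[R]_n) :
  differentiable f x -> 'D_v f x = dot (grad f x) v.
Proof.
move=> df; rewrite deriveE// {1}(row_sum_delta v) linear_sum.
by apply: eq_bigr => i _; rewrite linearZ /= mxE deriveE// mulrC.
Qed.

Lemma is_derive_line {R : realType} {n : nat} (f : 'rV[R]_n -> R)
    (x v : 'rV[R]_n) (t : R) :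
  differentiable f (x + t *: v) ->
  is_derive t 1 (fun s : R => f (x + s *: v)) (dot (grad f (x + t *: v)) v).
Proof.
move=> df; have dv := @diff_derivable _ _ _ f _ v df.
(* The difference quotients of the line restriction at [t] coincide with those of [f] at
   [x + t *: v] along [v], so both derivability and the value of the derivative transfer. *)
have E : (fun h : R => h^-1 *: (((fun s : R => f (x + s *: v)) \o shift t)
     (h *: (1 : R)) - f (x + t *: v))) =
   (fun h : R => h^-1 *: ((f \o shift (x + t *: v)) (h *: v) - f (x + t *: v))).
  apply/funext => h /=; congr (_ *: (f _ - _)).
  by rewrite [h *: 1]mulr1 scalerDl addrCA.
apply: DeriveDef; first by rewrite /derivable E.
by rewrite -derive_grad// /derive E.
Qed.

(** Unpacks [convex_function], whose weights are elements of an interval type, into a form with a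
    real weight and explicit bounds. *)
Lemma convex_function_le {R : realType} {n : nat} (f : 'rV[R]_n -> R)
    (x y : 'rV[R]_n) (t : R) :
  convex_function setT f -> 0 <= t -> t <= 1 ->
  f (t *: x + (1 - t) *: y) <= t * f x + (1 - t) * f y.
Proof.
move=> cf t0 t1.
have tP : Itv.spec (@Itv.num_sem R) (Itv.Real `[0%Z, 1%Z]) t.
  by rewrite /Itv.spec /= /Itv.num_sem /= num_real /= in_itv /= t0 t1.
by apply: (cf (Itv.Def tP) x y); rewrite inE.
Qed.

(** By convexity, the slope of [f] from [x] towards [y] over a step [h] in (0, 1] is at most
    [f y - f x]. The directional derivative is the limit of these slopes as [h] tends to 0 from the
    right. *)
Lemma convex_grad_le {R : realType} {n : nat} (f : 'rV[R]_n -> R)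
    (x y : 'rV[R]_n) :
  convex_function setT f -> differentiable f x ->
  f x + dot (grad f x) (y - x) <= f y.
Proof.
move=> cf df; rewrite -lerBrDl -derive_grad//.
have /cvg_dnbhs_at_right cv := @diff_derivable _ _ _ f _ (y - x) df.
rewrite /derive -(cvg_lim _ cv)//.
apply: limr_le; first by apply/cvg_ex; eexists; exact: cv.
near=> h.
have h0 : 0 < h by near: h; exact: nbhs_right_gt.
have h1 : h <= 1 by near: h; exact: nbhs_right_le.
have H := convex_function_le f y x h cf (ltW h0) h1.
rewrite ler_pdivrMl//=.
have -> : h *: (y - x) + x = h *: y + (1 - h) *: x.
  by rewrite scalerBr scalerBl scale1r addrAC -addrA.
move: H => /=; lra.
Unshelve. all: by end_near. Qed.

(** The mean value theorem replaces integration of the gradient: [phi] subtracts the linear and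
    quadratic terms along the segment, so the claim is [phi 1 <= phi 0], and it suffices that [dphi]
    is nonpositive at the mean value point. *)
Lemma smooth_descent {R : realType} {n : nat} (L : R) (f : 'rV[R]_n -> R)
    (x v : 'rV[R]_n) :
  0 < L -> smooth L f ->
  f (x + v) <= f x + dot (grad f x) v + L / 2 * dot v v.
Proof.
move=> L0 [df lipf].
pose phi (t : R) :=
  f (x + t *: v) - t * dot (grad f x) v - t ^+ 2 * (L / 2 * dot v v).
pose dphi (t : R) := dot (grad f (x + t *: v) - grad f x) v - L * t * dot v v.
have dphiP (t : R) : is_derive t 1 phi (dphi t).
  have := is_derive_line f x v t (df _) => dl.
  rewrite /phi; apply: is_derive_eq.
  by rewrite /dphi !dotE /GRing.scale /=; field.
have phi_cont : {within `[0, 1], continuous phi}.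
  apply: derivable_within_continuous => t _.
  by have := dphiP t => ?; exact: ex_derive.
have [c] := MVT ltr01 (fun t _ => dphiP t) phi_cont.
rewrite in_itv /= => /andP[c0 c1].
suff dphi0 : dphi c <= 0.
  by rewrite /phi subr0 mulr1 scale1r scale0r addr0; lra.
have := lipf (x + c *: v) x.
rewrite -(ler_pXn2r (ltn0Sn 1)) ?nnegrE ?mulr_ge0 ?sqrtr_ge0 ?(ltW L0)//.
rewrite exprMn !enorm_sqr addrAC subrr add0r /dphi.
move: (grad f _ - grad f x) => w; rewrite !dotE => H.
(* Expanding [0 <= |w - L c v|^2] replaces Cauchy-Schwarz here. *)
have := dot_ge0 (w - (L * c) *: v); rewrite !dotE (dotC v w) => H2.
(* With |w|^2 <= (L c)^2 |v|^2 from the Lipschitz bound, the expansion gives 2 L c <w, v> <= 2 (L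
   c)^2 |v|^2. Dividing by L c is allowed because the mean value point [c] is interior. *)
have Lc : 0 < L * c by rewrite mulr_gt0.
by rewrite subr_le0 -(ler_pM2l Lc); lra.
Qed.

Lemma grad_cocoercive {R : realType} {n : nat} (L : R) (f : 'rV[R]_n -> R)
    (x y : 'rV[R]_n) :
  0 < L -> convex_function setT f -> smooth L f ->
  dot (grad f x - grad f y) (grad f x - grad f y) <=
    L * dot (grad f x - grad f y) (x - y).
Proof.
move=> L0 cf sf.
(* Both bounds are taken at the point [a - w / L], which minimizes the quadratic
   upper model of [f - <grad f b, .>] at [a]. *)
have half a b : f b + dot (grad f b) (a - b) +
    L^-1 / 2 * dot (grad f a - grad f b) (grad f a - grad f b) <= f a.
  set w := grad f a - grad f b.
  have E : grad f a = w + grad f b by rewrite subrK.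
  have := smooth_descent L f a (- (L^-1 *: w)) L0 sf.
  have := convex_grad_le f b (a - L^-1 *: w) cf (sf.1 b).
  (* Writing [grad f a] as [w + grad f b] makes the cross terms <grad f b, w> of the two bounds
     cancel. What remains is -|w|^2 / L + |w|^2 / (2 L) = -|w|^2 / (2 L). *)
  rewrite E; clearbody w.
  rewrite !dotE => H1 H2.
  have E1 : L / 2 * (L^-1 * (L^-1 * dot w w)) = L^-1 / 2 * dot w w.
    by field; rewrite gt_eqF.
  lra.
(* Adding [half] to its copy with the points swapped cancels the values of [f], and the two halves
   add up to the factor [L^-1]. *)
rewrite -ler_pdivrMl//; have := half x y; have := half y x.
rewrite !dotE (dotC (grad f y) (grad f x)); lra.
Qed.

Theorem theorem3 (R : realType) (n : nat) (L : R) (f : 'rV[R]_n -> R)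
    (eta : R) (x : nat -> 'rV[R]_n) :
  0 < L ->
  convex_function setT f ->
  smooth L f ->
  0 < eta <= 2 / L ->
  (forall k : nat, (1 <= k)%N -> x k = x k.-1 - eta *: grad f (x k.-1)) ->
  nonincreasing_seq (fun k : nat => enorm (grad f (x k))).
Proof.
move=> L0 cf sf /andP[eta0 etaL] step; apply/nonincreasing_seqP => k.
have /= xS := step k.+1 isT.
rewrite !enormE ler_sqrt ?dot_ge0//.
have := grad_cocoercive L f (x k) (x k.+1) L0 cf sf.
have -> : x k - x k.+1 = eta *: grad f (x k) by rewrite xS opprB addrC subrK.
set g := grad f (x k); set w := g - grad f (x k.+1).
have -> : grad f (x k.+1) = g - w by rewrite subKr.
clearbody g w.
rewrite dotZr mulrA => coco.
have Leta : L * eta <= 2 by rewrite mulrC -ler_pdivlMr.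
have Leta0 : 0 < L * eta by rewrite mulr_gt0.
(* Raising the factor [L * eta] to 2 requires [dot w g] to be nonnegative. This follows from [coco]
   itself, since 0 <= |w|^2 <= L eta <w, g> with L eta > 0. *)
have : dot w w <= 2 * dot w g.
  apply: (le_trans coco); rewrite ler_wpM2r//.
  by rewrite -(pmulr_rge0 _ Leta0); exact: le_trans (dot_ge0 w) coco.
by rewrite !dotE (dotC g w); lra.
Qed.
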